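(* Let $a>0$ and $0<t<1$, and for $s>0$ let $$A_s(z)=\frac{(z+a(1-t)^2)(z+st(1-t))^2}{z^2}.$$ Put $s^*=\frac{a(1-t)}{t}$. Then for each $s>0$ we have $\Gamma_1(s)\subset[0,\infty)$ and $\Gamma_2(s)\subset(-\infty,0]$. More precisely, there exist $\eta(s)\le 0\le\beta(s)<\gamma(s)$ such that $$\Gamma_1(s)=[\beta(s),\gamma(s)],\qquad \Gamma_2(s)=(-\infty,\eta(s)].$$ In addition: (a) $s\mapsto\gamma(s)$ is strictly increasing for $s>0$, $\lim_{s\to0^+}\gamma(s)=a(1-t)^2$, and $\lim_{s\to\infty}\gamma(s)=+\infty$; (b) $s\mapsto\beta(s)$ is positive and strictly decreasing for $0<s<s^*$, and $\beta(s)=0$ for $s\ge s^*$; furthermore $\lim_{s\to0^+}\beta(s)=a(1-t)^2$; (c) $\eta(s)=0$ for $0<s\le s^*$, and $s\mapsto\eta(s)$ is negative and strictly decreasing for $s>s^*$, with $\lim_{s\to\infty}\eta(s)=-\infty$.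
   Context: For $x\in\mathbb{C}$ and $s>0$, let $z_1(x,s),z_2(x,s),z_3(x,s)$ be the three solutions (counted with multiplicity) of the equation $A_s(z)=x$, labelled so that $|z_1(x,s)|\ge|z_2(x,s)|\ge|z_3(x,s)|>0$. Define $$\Gamma_1(s)=\{x\in\mathbb{C}:|z_1(x,s)|=|z_2(x,s)|\},\qquad \Gamma_2(s)=\{x\in\mathbb{C}:|z_2(x,s)|=|z_3(x,s)|\}.$$ *)

(* Defs.v *)
From HB Require Import structures.
From mathcomp Require Import all_boot all_order all_algebra.
From mathcomp Require Export complex.
From mathcomp Require Import all_classical all_reals all_analysis.
Export numFieldNormedType.Exports.

Set Implicit Arguments.
Unset Strict Implicit.
Unset Printing Implicit Defensive.

Import Order.TTheory GRing.Theory Num.Theory.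
Local Open Scope classical_set_scope.
Local Open Scope ring_scope.
Local Open Scope complex_scope.

Section Symbol.
Variables (R : realType) (a t : R).
Implicit Types (s : R) (x z : R[i]).

(* By convention 0^-1 = 0, so [symbol s 0] is a junk value: every use of     *)
(* [symbol s z] below is guarded by [z != 0].                                *)
Definition symbol s z : R[i] :=
  (z + (a * (1 - t) ^+ 2)%:C) * (z + (s * t * (1 - t))%:C) ^+ 2 / z ^+ 2.

(* z1, z2, z3 are the solutions of [symbol s z = x], repeated according to    *)
(* multiplicity: the rational function [symbol s - x], whose only finite pole *)
(* is the double pole at 0, has the zeros z1, z2, z3.  The lemmas             *)
(* [count_solutions], [ordered_solutions_ex] and [ordered_solutions_norm]     *)
(* relate this to root multiplicities and show that the moduli are well       *)
(* defined.                                                                  *)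
Definition ordered_solutions s x z1 z2 z3 : Prop :=
  (forall z, z != 0 ->
     symbol s z - x = (z - z1) * (z - z2) * (z - z3) / z ^+ 2) /\
  [/\ `|z2| <= `|z1|, `|z3| <= `|z2| & 0 < `|z3|].

Definition Gamma1 s : set R[i] := [set x |
  exists z1 z2 z3, ordered_solutions s x z1 z2 z3 /\ `|z1| = `|z2|].

Definition Gamma2 s : set R[i] := [set x |
  exists z1 z2 z3, ordered_solutions s x z1 z2 z3 /\ `|z2| = `|z3|].

Definition numerator s x : {poly R[i]} :=
  ('X + (a * (1 - t) ^+ 2)%:C%:P) * ('X + (s * t * (1 - t))%:C%:P) ^+ 2
  - x *: 'X^2.

Lemma symbol_numerator s x z :
  z != 0 -> symbol s z - x = (numerator s x).[z] / z ^+ 2.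
Proof.
move=> z0; rewrite /symbol /numerator hornerD hornerN hornerM hornerZ.
rewrite horner_exp !hornerD !hornerC hornerXn hornerX.
by rewrite mulrBl mulfK // expf_neq0.
Qed.

Lemma eq_poly_neq0 (p q : {poly R[i]}) :
  (forall z, z != 0 -> p.[z] = q.[z]) -> p = q.
Proof.
move=> pq; apply/eqP; rewrite -subr_eq0; apply/eqP.
pose rs := [seq (n.+1)%:R : R[i] | n <- iota 0 (size (p - q))].
apply: (@roots_geq_poly_eq0 _ _ rs); last by rewrite size_map size_iota.
- apply/allP => _ /mapP [n _ ->].
  by rewrite /root hornerD hornerN pq ?subrr // pnatr_eq0.
- rewrite map_inj_uniq ?iota_uniq // => m n /eqP.
  by rewrite eqr_nat eqSS => /eqP.
Qed.

Lemma solutions_numerator s x z1 z2 z3 :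
  (forall z, z != 0 ->
     symbol s z - x = (z - z1) * (z - z2) * (z - z3) / z ^+ 2) <->
  numerator s x = \prod_(w <- [:: z1; z2; z3]) ('X - w%:P).
Proof.
have hornerE3 z : (\prod_(w <- [:: z1; z2; z3]) ('X - w%:P)).[z] =
    (z - z1) * (z - z2) * (z - z3).
  by rewrite !big_cons big_nil mulr1 !hornerM !hornerXsubC mulrA.
split=> [sol|eqp z z0]; last by rewrite symbol_numerator // eqp hornerE3.
apply: eq_poly_neq0 => z z0; rewrite hornerE3.
have z20 : (z ^+ 2)^-1 != 0 by rewrite invr_eq0 expf_neq0.
by apply: (mulIf z20); rewrite -sol // symbol_numerator.
Qed.

Lemma count_solutions s x z1 z2 z3 z : ordered_solutions s x z1 z2 z3 ->
  count_mem z [:: z1; z2; z3] = mup z (numerator s x).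
Proof. by move=> [/solutions_numerator -> _]; rewrite mu_prod_XsubC. Qed.

Lemma mem_solutions s x z1 z2 z3 z : ordered_solutions s x z1 z2 z3 ->
  z \in [:: z1; z2; z3] <-> z != 0 /\ symbol s z = x.
Proof.
move=> [sol [z21 z32 z3_gt0]].
have z2_gt0 := lt_le_trans z3_gt0 z32; have z1_gt0 := lt_le_trans z2_gt0 z21.
move: z1_gt0 z2_gt0 z3_gt0; rewrite !normr_gt0 => z10 z20 z30.
split=> [zin|[z0 Az]].
  have z0 : z != 0 by move: zin; rewrite !inE => /or3P[] /eqP ->.
  split=> //; apply/eqP; rewrite -subr_eq0 sol //.
  by move: zin; rewrite !inE => /or3P[] /eqP ->; rewrite subrr !(mulr0, mul0r).
move/eqP: (sol z z0); rewrite Az subrr eq_sym !mulf_eq0 invr_eq0.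
by rewrite expf_eq0 (negPf z0) /= orbF !subr_eq0 !inE orbA.
Qed.

Lemma ordered_solutions_norm s x z1 z2 z3 w1 w2 w3 :
  ordered_solutions s x z1 z2 z3 -> ordered_solutions s x w1 w2 w3 ->
  [/\ `|z1| = `|w1|, `|z2| = `|w2| & `|z3| = `|w3|].
Proof.
move=> zP wP.
have zw : perm_eq [:: z1; z2; z3] [:: w1; w2; w3].
  apply/allP => z _; apply/eqP.
  exact: etrans (count_solutions z zP) (esym (count_solutions z wP)).
case: zP wP => _ [z21 z32 _] [_ [w21 w32 _]].
suff eqn : map Num.norm [:: z1; z2; z3] = map Num.norm [:: w1; w2; w3].
  pose coef i := congr1 (fun l : seq R[i] => nth 0 l i) eqn.
  by split; [exact: coef 0%N | exact: coef 1%N | exact: coef 2%N].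
apply: (@sorted_eq _ (fun u v : R[i] => v <= u)).
- by move=> u v w uv vw; exact: le_trans vw uv.
- by move=> u v /andP[uv vu]; apply/le_anti; rewrite uv vu.
- by rewrite /= z21 z32.
- by rewrite /= w21 w32.
- exact: perm_map.
Qed.

Lemma ordered_solutions_ex s x : 0 < a -> 0 < t < 1 -> 0 < s ->
  exists z1 z2 z3, ordered_solutions s x z1 z2 z3.
Proof.
move=> a0 /andP[t0 t1] s0.
set c := a * (1 - t) ^+ 2; set d := s * t * (1 - t).
have t10 : 0 < 1 - t by rewrite subr_gt0.
have fE : ('X + c%:C%:P) * ('X + d%:C%:P) ^+ 2 =
    \prod_(w <- [:: - c%:C; - d%:C; - d%:C]) ('X - w%:P).
  by rewrite !big_cons big_nil !polyCN !opprK mulr1 expr2.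
have szx : (size (- (x *: 'X^2) : {poly R[i]}) < 4)%N.
  by rewrite size_polyN (leq_ltn_trans (size_scale_leq _ _)) // size_polyXn.
have sznum : size (numerator s x) = 4%N.
  by rewrite /numerator fE size_polyDl size_prod_XsubC.
have moni : lead_coef (numerator s x) = 1.
  rewrite /numerator fE lead_coefDl ?size_prod_XsubC //.
  exact: (monicP (monic_prod_XsubC _ _ _)).
have [r] := closed_field_poly_normal (numerator s x).
rewrite moni scale1r => numE.
pose ge := fun u v : R[i] => `|v| <= `|u|.
have ge_total : total ge by move=> u v; exact: real_leVge.
move: numE; rewrite -(perm_big _ (permEl (perm_sort ge r))) /=.
move: (sort_sorted ge_total r); set r' := sort _ _ => r'_sorted numE.
have : size r' = 3%N by move: sznum; rewrite numE size_prod_XsubC => -[].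
case: r' r'_sorted numE => [|z1 [|z2 [|z3 [|]]]] //= /and3P[z21 z32 _] numE _.
exists z1, z2, z3; split; first exact/solutions_numerator.
split=> //; rewrite normr_gt0; apply/eqP => z30.
have : root (numerator s x) z3 by rewrite numE root_prod_XsubC !inE eqxx !orbT.
rewrite z30 /root /numerator fE hornerD hornerN hornerZ hornerXn expr0n /=.
rewrite mulr0 subr0 -/(root _ _) root_prod_XsubC !inE !(eq_sym 0) !oppr_eq0.
have c0 : 0 < c by rewrite mulr_gt0 // exprn_gt0.
have d0 : 0 < d by rewrite !mulr_gt0.
by rewrite !(fmorph_eq0 (@real_complex R)) !gt_eqF.
Qed.

End Symbol.

(* Main.v *)
Require Import Defs.
From HB Require Import structures.
From mathcomp Require Import all_boot all_order all_algebra.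
From mathcomp Require Import complex.
From mathcomp Require Import all_classical all_reals all_analysis.
From mathcomp Require Import ring lra.

(** Put c = a (1 - t)^2 and d = s t (1 - t), so that s is below the threshold
exactly when d < c, and the solutions of A_s(z) = x are the roots of the cubic
(z + c) (z + d)^2 - x z^2.

Two roots z, w of equal modulus satisfy |z + c| |z + d|^2 = |w + c| |w + d|^2.
On a circle about 0 both |z + c| and |z + d| increase strictly with the real
part of z, so z and w have the same real part: they are equal or conjugate
([eq_norm_conj]).  In the first case the discriminant of the cubic vanishes; in
the second x is real, the third root is real, and the discriminant is at most 0.
As a function of x the discriminant is 4 c d^2 x (x - gamma) (x - m), where
0, gamma and m are the critical values of A_s ([discriminant_crit]).  Hence x is
real and x (x - gamma) (x - m) <= 0 ([equimodular_real]).

Conversely such an x yields roots z, z^*, -n with n > 0, and the sign of x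
decides which modulus is larger ([conj_pair_norm]): the pair dominates for x > 0
and is dominated for x < 0, while for x = 0 the roots are -c, -d, -d.  Since
m < gamma, 0 < gamma and m has the sign of c - d, it follows that
Gamma1 = [max(0, m), gamma] and Gamma2 = (-oo, min(0, m)].

It remains to follow gamma and m as d grows. The critical points z of A_s other
than the zero -d solve z^2 = d (z + 2c); with u = z + 2c this reads (u - 2c)^2 =
d u, and the critical value is h(u) = 4 (u - c)^3 / u^2 for both solutions u,
whose product is 4 c^2. The function h is strictly increasing on u > 0
([crit_value_lt]) and the larger solution increases with d, so gamma increases
and m decreases. Both tend to h(2c) = c as d tends to 0, and explicit linear
bounds give the limits at infinity. *)

Set Implicit Arguments.
Unset Strict Implicit.
Unset Printing Implicit Defensive.

Import Order.TTheory GRing.Theory Num.Theory.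
Import numFieldNormedType.Exports.
Local Open Scope classical_set_scope.
Local Open Scope ring_scope.
Local Open Scope complex_scope.

Local Notation Re := complex.Re.
Local Notation Im := complex.Im.

(** * The nonzero critical values of the symbol *)

(** The value of A_s at a critical point z other than -d, in the variable
u = z + 2c; the parameter d is eliminated by (u - 2c)^2 = d u. *)
Definition crit_value (R : realType) (c u : R) : R := 4 * (u - c) ^+ 3 / u ^+ 2.

(** With u = p^2 and v = q^2, the difference of the values at v and u has the
sign of c^3 (q - p)^2 + p q (p q - c)^2 (p q + 2c). *)
Lemma crit_value_lt (R : realType) (c u v : R) :
  0 < c -> 0 < u -> u < v -> crit_value c u < crit_value c v.
Proof.
move=> c0 u0 uv; have v0 : 0 < v by exact: lt_trans uv.
have -> : crit_value c v = crit_value c u +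
    4 * ((v - u) * ((u * v) ^+ 2 - 3 * c ^+ 2 * (u * v) + c ^+ 3 * (u + v)))
      / (u ^+ 2 * v ^+ 2).
  by rewrite /crit_value; field; rewrite !gt_eqF.
rewrite ltrDl divr_gt0 ?mulr_gt0 ?exprn_gt0 ?subr_gt0 //.
set p := Num.sqrt u; set q := Num.sqrt v.
have p0 : 0 < p by rewrite sqrtr_gt0.
have q0 : 0 < q by rewrite sqrtr_gt0.
have pq : p < q by rewrite ltr_sqrt.
rewrite -(sqr_sqrtr (ltW u0)) -(sqr_sqrtr (ltW v0)) -/p -/q.
have -> : (p ^+ 2 * q ^+ 2) ^+ 2 - 3 * c ^+ 2 * (p ^+ 2 * q ^+ 2) +
    c ^+ 3 * (p ^+ 2 + q ^+ 2) =
    c ^+ 3 * (q - p) ^+ 2 + p * q * ((p * q - c) ^+ 2 * (p * q + 2 * c)).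
  by ring.
have pq0 : 0 <= p * q by rewrite mulr_ge0 ?ltW.
rewrite ltr_wpDr ?mulr_gt0 ?exprn_gt0 ?subr_gt0 //.
by apply: mulr_ge0 => //; apply: mulr_ge0; [exact: sqr_ge0 | lra].
Qed.

(** The larger solution u of (u - 2c)^2 = d u; the smaller one is 4 c^2 / u. *)
Definition saddle (R : realType) (c d : R) : R :=
  2 * c + (d + Num.sqrt (d ^+ 2 + 8 * c * d)) / 2.

Lemma saddle_ge (R : realType) (c d : R) : 0 < c -> 0 < d ->
  2 * c + d <= saddle c d.
Proof.
move=> c0 d0; rewrite /saddle.
suff : d <= Num.sqrt (d ^+ 2 + 8 * c * d) by lra.
rewrite -[leLHS](ger0_norm (ltW d0)) -sqrtr_sqr ler_wsqrtr // lerDl.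
by rewrite !mulr_ge0 ?ltW.
Qed.

Lemma saddle_lt (R : realType) (c d e : R) : 0 < c -> 0 < d -> d < e ->
  saddle c d < saddle c e.
Proof.
move=> c0 d0 de; rewrite /saddle.
suff : Num.sqrt (d ^+ 2 + 8 * c * d) <= Num.sqrt (e ^+ 2 + 8 * c * e) by lra.
by apply: ler_wsqrtr; nra.
Qed.

Lemma saddle_eq (R : realType) (c d : R) : 0 < c -> 0 < d ->
  d = (saddle c d - 2 * c) ^+ 2 / saddle c d.
Proof.
move=> c0 d0; have := saddle_ge c0 d0; rewrite /saddle.
set w := Num.sqrt _ => uge.
have w2 : w ^+ 2 = d ^+ 2 + 8 * c * d.
  by rewrite sqr_sqrtr // addr_ge0 ?sqr_ge0 ?mulr_ge0 ?ltW.
have u0 : 2 * c + (d + w) / 2 != 0 by rewrite gt_eqF; lra.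
apply: (mulIf u0); rewrite divfK //.
rewrite (_ : (_ - _) ^+ 2 = (d ^+ 2 + 2 * d * w + w ^+ 2) / 4); last by field.
by rewrite w2; field.
Qed.

Definition crit_pos (R : realType) (c d : R) := crit_value c (saddle c d).
Definition crit_neg (R : realType) (c d : R) :=
  crit_value c (4 * c ^+ 2 / saddle c d).

(** The left-hand side is the factor of the discriminant whose roots are the
nonzero critical values.  Substituting d = (u - 2c)^2 / u makes all terms
rational in c and u. *)
Lemma crit_factor (R : realType) (c d r : R) : 0 < c -> 0 < d ->
  4 * c * r ^+ 2 - (8 * c ^+ 2 + 20 * c * d - d ^+ 2) * r + 4 * (c - d) ^+ 3 =
  4 * c * ((r - crit_pos c d) * (r - crit_neg c d)).
Proof.
move=> c0 d0; have := saddle_ge c0 d0; have := saddle_eq c0 d0.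
rewrite /crit_pos /crit_neg; set u := saddle _ _ => dE uge.
have u0 : u != 0 by rewrite gt_eqF; lra.
rewrite dE /crit_value; field; rewrite u0 gt_eqF //.
Qed.

(** u = 2c separates the two solutions of (u - 2c)^2 = d u, and is their common
limit as d tends to 0. *)
Lemma crit_value_mid (R : realType) (c : R) : 0 < c -> crit_value c (2 * c) = c.
Proof. by move=> c0; rewrite /crit_value; field; rewrite gt_eqF. Qed.

Lemma crit_pos_gt (R : realType) (c d : R) : 0 < c -> 0 < d -> c < crit_pos c d.
Proof.
move=> c0 d0; rewrite -[ltLHS](crit_value_mid c0) crit_value_lt //; first lra.
by have := saddle_ge c0 d0; lra.
Qed.

Lemma crit_neg_lt (R : realType) (c d : R) : 0 < c -> 0 < d -> crit_neg c d < c.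
Proof.
move=> c0 d0; have := saddle_ge c0 d0 => ug; have u0 : 0 < saddle c d by lra.
rewrite -[ltRHS](crit_value_mid c0) crit_value_lt //.
  by rewrite divr_gt0 ?mulr_gt0 ?exprn_gt0.
by rewrite ltr_pdivrMr //; nra.
Qed.

Lemma crit_pos_lt (R : realType) (c d e : R) : 0 < c -> 0 < d -> d < e ->
  crit_pos c d < crit_pos c e.
Proof.
move=> c0 d0 de; apply: crit_value_lt => //; last exact: saddle_lt.
by have := saddle_ge c0 d0; lra.
Qed.

Lemma crit_neg_gt (R : realType) (c d e : R) : 0 < c -> 0 < d -> d < e ->
  crit_neg c e < crit_neg c d.
Proof.
move=> c0 d0 de; have u0 : 0 < saddle c d by have := saddle_ge c0 d0; lra.
have ue := saddle_lt c0 d0 de; have v0 := lt_trans u0 ue.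
apply: crit_value_lt => //; first by rewrite divr_gt0 ?mulr_gt0 ?exprn_gt0.
by rewrite ltr_pM2l ?mulr_gt0 ?exprn_gt0 // ltf_pV2.
Qed.

(** For d = c the two zeros -c and -d of the symbol merge into a triple one,
which is then the negative critical point. *)
Lemma crit_neg_diag (R : realType) (c : R) : 0 < c -> crit_neg c c = 0.
Proof.
move=> c0; suff -> : crit_neg c c = crit_value c c.
  by rewrite /crit_value subrr expr0n /= mulr0 mul0r.
rewrite /crit_neg /saddle (_ : c ^+ 2 + 8 * c * c = (3 * c) ^+ 2); last by ring.
rewrite sqrtr_sqr gtr0_norm ?mulr_gt0 //; congr crit_value.
by field; rewrite gt_eqF //; lra.
Qed.

Lemma crit_pos_ge (R : realType) (c d : R) : 0 < c -> 0 < d ->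
  4 * d - 4 * c <= crit_pos c d.
Proof.
move=> c0 d0; have ug := saddle_ge c0 d0; have u0 : 0 < saddle c d by lra.
apply: (@le_trans _ _ (4 * (saddle c d - 3 * c))); first by lra.
by rewrite /crit_pos /crit_value ler_pdivlMr ?exprn_gt0 //; nra.
Qed.

(** Follows from the lower bound on the other critical value, the sum of the two
being known from [crit_factor]. *)
Lemma crit_neg_le (R : realType) (c d : R) : 0 < c -> 0 < d ->
  crit_neg c d <= 10 * c - d.
Proof.
move=> c0 d0; have ug := crit_pos_ge c0 d0.
(* Comparing the factorization at r = 0 and r = 1 isolates the sum. *)
have h0 := crit_factor 0 c0 d0; have h1 := crit_factor 1 c0 d0.
have : 4 * c * (crit_pos c d + crit_neg c d) = 8 * c ^+ 2 + 20 * c * d - d ^+ 2.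
  by lra.
move=> h; rewrite -(ler_pM2l (_ : 0 < 4 * c)); last lra.
have : 0 <= c * (crit_pos c d - (4 * d - 4 * c)).
  by rewrite mulr_ge0 ?subr_ge0 // ltW.
by have := sqr_ge0 (d - 4 * c); lra.
Qed.

Lemma crit_neg_gt0 (R : realType) (c d : R) : 0 < c -> 0 < d ->
  (0 < crit_neg c d) = (d < c).
Proof.
move=> c0 d0; rewrite -(crit_neg_diag c0).
have [dc|cd|->] := ltgtP d c; first exact: crit_neg_gt.
  by apply/negbTE; rewrite -leNgt ltW // crit_neg_gt.
exact: ltxx.
Qed.

Lemma crit_neg_lt0 (R : realType) (c d : R) : 0 < c -> 0 < d ->
  (crit_neg c d < 0) = (c < d).
Proof.
move=> c0 d0; rewrite -(crit_neg_diag c0).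
have [dc|cd|->] := ltgtP d c; last exact: ltxx.
  by apply/negbTE; rewrite -leNgt ltW // crit_neg_gt.
exact: crit_neg_gt.
Qed.

(** * Equimodular roots of the cubic *)

Section Cubic.
Variables (R : realType) (c d : R).
Hypotheses (c_gt0 : 0 < c) (d_gt0 : 0 < d).
Implicit Types (x z w : R[i]) (r n : R).

(** An identity of functions of z, because this form is immediately stable under
conjugation and under permutation of the roots. *)
Definition splits x z1 z2 z3 := forall z,
  (z + c%:C) * (z + d%:C) ^+ 2 - x * z ^+ 2 = (z - z1) * (z - z2) * (z - z3).

Lemma splitsC12 x z1 z2 z3 : splits x z1 z2 z3 -> splits x z2 z1 z3.
Proof. by move=> sp z; rewrite sp; ring. Qed.

Lemma splitsC23 x z1 z2 z3 : splits x z1 z2 z3 -> splits x z1 z3 z2.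
Proof. by move=> sp z; rewrite sp; ring. Qed.

Lemma vieta x z1 z2 z3 : splits x z1 z2 z3 ->
  [/\ z1 + z2 + z3 = x - c%:C - 2 * d%:C,
      z1 * z2 + z2 * z3 + z3 * z1 = d%:C * (2 * c%:C + d%:C) &
      z1 * z2 * z3 = - (c%:C * d%:C ^+ 2)].
Proof.
(* The elementary symmetric functions are read off from the values of the
   cubic at 0, 1 and -1. *)
pose q z := (z - z1) * (z - z2) * (z - z3); move=> sp; split.
- rewrite (_ : z1 + z2 + z3 = q 0 - (q 1 + q (-1)) / 2); last first.
    by rewrite /q; field.
  by rewrite /q -!sp; field.
- rewrite (_ : _ + z3 * z1 = (q 1 - q (-1)) / 2 - 1); last first.
    by rewrite /q; field.
  by rewrite /q -!sp; field.
- rewrite (_ : z1 * z2 * z3 = - q 0); last by rewrite /q; ring.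
  by rewrite /q -!sp; ring.
Qed.

(** The classical formula for the discriminant of a monic cubic in terms of its
coefficients. *)
Lemma discriminant x z1 z2 z3 : splits x z1 z2 z3 ->
  ((z1 - z2) * (z2 - z3) * (z3 - z1)) ^+ 2 =
  d%:C ^+ 2 * x * (4 * c%:C * x ^+ 2 -
    (8 * c%:C ^+ 2 + 20 * c%:C * d%:C - d%:C ^+ 2) * x +
    4 * (c%:C - d%:C) ^+ 3).
Proof.
move=> /vieta[e1 e2 e3].
rewrite (_ : ((z1 - z2) * (z2 - z3) * (z3 - z1)) ^+ 2 =
  (z1 + z2 + z3) ^+ 2 * (z1 * z2 + z2 * z3 + z3 * z1) ^+ 2
  - 4 * (z1 * z2 + z2 * z3 + z3 * z1) ^+ 3
  - 4 * (z1 + z2 + z3) ^+ 3 * (z1 * z2 * z3)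
  + 18 * (z1 + z2 + z3) * (z1 * z2 + z2 * z3 + z3 * z1) * (z1 * z2 * z3)
  - 27 * (z1 * z2 * z3) ^+ 2); last by ring.
by rewrite e1 e2 e3; ring.
Qed.

Lemma discriminant_crit x z1 z2 z3 : splits x z1 z2 z3 ->
  ((z1 - z2) * (z2 - z3) * (z3 - z1)) ^+ 2 =
  (4 * c * d ^+ 2)%:C * (x * (x - (crit_pos c d)%:C) * (x - (crit_neg c d)%:C)).
Proof.
move=> /discriminant ->.
(* The values at r = 0 and r = 1 give the product and the sum of the two
   critical values. *)
have h0 := crit_factor 0 c_gt0 d_gt0; have h1 := crit_factor 1 c_gt0 d_gt0.
have prodE : 4 * (c%:C - d%:C) ^+ 3 =
    4 * c%:C * ((crit_pos c d)%:C * (crit_neg c d)%:C).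
  rewrite -!(rmorphM, rmorphB, rmorphXn, rmorphD, rmorph_nat (real_complex R)).
  by congr _%:C; lra.
have sumE : 8 * c%:C ^+ 2 + 20 * c%:C * d%:C - d%:C ^+ 2 =
    4 * c%:C * ((crit_pos c d)%:C + (crit_neg c d)%:C).
  rewrite -!(rmorphM, rmorphB, rmorphXn, rmorphD, rmorph_nat (real_complex R)).
  by congr _%:C; lra.
by rewrite prodE sumE !(rmorphM, rmorphXn, rmorph_nat) /=; ring.
Qed.

Lemma splits_root x z1 z2 z3 : splits x z1 z2 z3 ->
  (z1 + c%:C) * (z1 + d%:C) ^+ 2 = x * z1 ^+ 2.
Proof. by move=> /(_ z1); rewrite subrr !mul0r => /subr0_eq. Qed.

Lemma splits_neq0 x z1 z2 z3 : splits x z1 z2 z3 -> z1 != 0.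
Proof.
move=> /vieta[_ _ /eqP]; apply: contraTneq => ->.
rewrite !mul0r eq_sym oppr_eq0 mulf_eq0 expf_eq0 /=.
by rewrite !(fmorph_eq0 (@real_complex R)) !gt_eqF.
Qed.

(** |z + r|^2 = |z|^2 + r^2 + 2 r Re z. *)
Lemma normD_lt z w r : 0 < r -> `|z| = `|w| -> Re z < Re w ->
  `|z + r%:C| < `|w + r%:C|.
Proof.
move=> r0 zw Rzw; rewrite -(@ltr_pXn2r _ 2) ?nnegrE //.
move: (congr1 (fun y => y ^+ 2) zw); rewrite -!add_Re2_Im2 => /complexI.
case: z w Rzw {zw} => [z1 z2] [w1 w2] /= Rzw zw; rewrite ltcR !addr0.
have : 0 < r * (w1 - z1) by rewrite mulr_gt0 ?subr_gt0.
by lra.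
Qed.

(** Taking norms in the two equations gives
|z + c| |z + d|^2 = |w + c| |w + d|^2, whereas both factors increase strictly
with the real part on a circle. *)
Lemma eq_norm_Re x z w : z != 0 -> `|z| = `|w| ->
  (z + c%:C) * (z + d%:C) ^+ 2 = x * z ^+ 2 ->
  (w + c%:C) * (w + d%:C) ^+ 2 = x * w ^+ 2 -> Re z = Re w.
Proof.
wlog Rzw : z w / Re z < Re w => [hwlog|] z0 zw zP wP.
  have [||//] := ltgtP (Re z) (Re w) => Rzw; first exact: hwlog.
  by symmetry; apply: hwlog => //; rewrite -normr_gt0 -zw normr_gt0.
have : `|z + c%:C| * `|z + d%:C| ^+ 2 < `|w + c%:C| * `|w + d%:C| ^+ 2.
  apply: ltr_pM; rewrite ?exprn_ge0 //; first exact: normD_lt.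
  by rewrite ltr_pXn2r ?nnegrE //; exact: normD_lt.
by rewrite -!normrX -!normrM zP wP !(normrM x) !normrX zw ltxx.
Qed.

Lemma eq_norm_conj x z1 z2 z3 : splits x z1 z2 z3 -> `|z1| = `|z2| ->
  z1 = z2 \/ z2 = z1^*.
Proof.
move=> sp n12.
have := eq_norm_Re (splits_neq0 sp) n12 (splits_root sp)
  (splits_root (splitsC12 sp)).
move: (congr1 (fun y => y ^+ 2) n12); rewrite -!add_Re2_Im2 => /complexI.
case: z1 z2 {sp n12} => [a1 b1] [a2 b2] /= ab a12; rewrite a12 in ab *.
move/addrI/eqP: ab; rewrite eqf_sqr => /orP[] /eqP ->; first by left.
by right; rewrite opprK.
Qed.

(** The discriminant attached to a conjugate pair and a real number, in a form
that shows its sign. *)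
Lemma conj_disc z r :
  ((z - z^*) * (z^* - r%:C) * (r%:C - z)) ^+ 2 =
  (- (4 * Im z ^+ 2 * ((Re z - r) ^+ 2 + Im z ^+ 2) ^+ 2))%:C.
Proof.
by case: z => [a b]; rewrite expr2; apply/eqP; rewrite eq_complex /=;
  apply/andP; split; apply/eqP; ring.
Qed.

Lemma splits_conj r z1 z2 z3 :
  splits r%:C z1 z2 z3 -> splits r%:C z1^* z2^* z3^*.
Proof.
move=> sp z; have := congr1 (@conjc R) (sp z^*).
by rewrite !(rmorphM, rmorphB, rmorphD, rmorphXn) /= !conjcK !oppr0.
Qed.

Lemma splits_third_real r z z3 : splits r%:C z z^* z3 -> z3 = (Re z3)%:C.
Proof.
move=> /vieta[e1 _ _]; apply/eqP; rewrite eq_complex /= eqxx /=.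
move/(congr1 (@complex.Im R)): e1; case: z z3 => [a b] [a3 b3] /=.
by move=> h; apply/eqP; lra.
Qed.

(** If w = z^* is also a root, conjugating the equation of z shows that x and
its conjugate have the same product with w^2. *)
Lemma splits_conj_real x z z3 : splits x z z^* z3 -> x = (Re x)%:C.
Proof.
move=> sp; have := congr1 (@conjc R) (splits_root sp).
rewrite !(rmorphM, rmorphD, rmorphXn) /= !oppr0 (splits_root (splitsC12 sp)).
move=> /(mulIf (expf_neq0 2 (splits_neq0 (splitsC12 sp)))).
case: x {sp} => [a b] [] /eqP; rewrite -addr_eq0 -mulr2n mulrn_eq0 /=.
by move=> /eqP ->.
Qed.

(** Equal roots annihilate the discriminant, hence x is one of its three real
zeros; conjugate ones make x real and the discriminant nonpositive. *)
Lemma equimodular_real x z1 z2 z3 : splits x z1 z2 z3 -> `|z1| = `|z2| ->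
  exists2 r, x = r%:C & r * (r - crit_pos c d) * (r - crit_neg c d) <= 0.
Proof.
have k0 : 0 < 4 * c * d ^+ 2 by rewrite !mulr_gt0 ?exprn_gt0.
move=> sp /(eq_norm_conj sp)[z12|z2E].
  move: (discriminant_crit sp).
  rewrite z12 subrr !mul0r expr0n /= => /esym /eqP.
  rewrite !mulf_eq0 (fmorph_eq0 (@real_complex R)) gt_eqF //= !subr_eq0.
  by move=> /orP[/orP[]|] /eqP ->; [exists 0 | exists (crit_pos c d)
    | exists (crit_neg c d)]; rewrite // ?subrr ?(mulr0, mul0r).
rewrite z2E in sp; have xr := splits_conj_real sp.
rewrite xr in sp; have z3r := splits_third_real sp.
rewrite z3r in sp; exists (Re x) => //.
move: (discriminant_crit sp); rewrite conj_disc -!(rmorphM, rmorphB) /=.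
move=> /complexI discE; rewrite -(pmulr_rle0 _ k0) -discE oppr_le0.
by rewrite mulr_ge0 ?sqr_ge0 // mulr_ge0 ?sqr_ge0.
Qed.

Lemma nonreal_conj_root r z1 z2 z3 : splits r%:C z1 z2 z3 -> Im z1 != 0 ->
  exists z n, splits r%:C z z^* (- n%:C).
Proof.
move=> sp Iz1; have z1J : z1^* != z1.
  case: z1 Iz1 {sp} => [a b] /= b0; rewrite eq_complex /= eqxx /=.
  by rewrite eqNr.
have := splits_root (splits_conj sp); move/eqP; rewrite -subr_eq0 sp.
rewrite !mulf_eq0 !subr_eq0 (negPf z1J) /= => /orP[] /eqP zE.
  exists z1, (- Re z3); rewrite -zE in sp.
  by rewrite rmorphN /= opprK -(splits_third_real sp).
exists z1, (- Re z2); rewrite -zE in sp; move/splitsC23 in sp.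
by rewrite rmorphN /= opprK -(splits_third_real sp).
Qed.

Lemma double_real_root r z1 z3 : splits r%:C z1 z1 z3 -> Im z1 = 0 ->
  exists z n, splits r%:C z z^* (- n%:C).
Proof.
move=> sp Iz1; have zJ : z1^* = z1.
  by case: z1 Iz1 {sp} => [a b] /= ->; rewrite oppr0.
rewrite -{2}zJ in sp; exists z1, (- Re z3).
by rewrite rmorphN /= opprK -(splits_third_real sp).
Qed.

(** A nonreal root comes with its conjugate.  If all roots are real, the
discriminant is a square, so the hypothesis forces it to vanish and a double
root plays the part of the conjugate pair. *)
Lemma conj_pair r z1 z2 z3 : splits r%:C z1 z2 z3 ->
  r * (r - crit_pos c d) * (r - crit_neg c d) <= 0 ->
  exists z n, splits r%:C z z^* (- n%:C).
Proof.
move=> sp disc_le0.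
have k0 : 0 < 4 * c * d ^+ 2 by rewrite !mulr_gt0 ?exprn_gt0.
have [I1|/(nonreal_conj_root sp)//] := eqVneq (Im z1) 0.
have [I2|/(nonreal_conj_root (splitsC12 sp))//] := eqVneq (Im z2) 0.
have [I3|/(nonreal_conj_root (splitsC12 (splitsC23 sp)))//] := eqVneq (Im z3) 0.
have : (z1 - z2) * (z2 - z3) * (z3 - z1) == 0.
  have := discriminant_crit sp.
  have toR z : Im z = 0 -> z = (Re z)%:C by case: z => [a b] /= ->.
  rewrite (toR _ I1) (toR _ I2) (toR _ I3) -!(rmorphM, rmorphB, rmorphXn) /=.
  move=> /complexI discE; rewrite (fmorph_eq0 (@real_complex R)) -sqrf_eq0.
  by rewrite eq_le sqr_ge0 discE andbT pmulr_rle0.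
rewrite !mulf_eq0 !subr_eq0 => /orP[/orP[]|] /eqP zE; rewrite zE in sp I1 I2 I3.
- exact: double_real_root sp I2.
- by apply: double_real_root I3; apply/splitsC23/splitsC12; exact: sp.
- by apply: double_real_root I1; apply/splitsC23; exact: sp.
Qed.

(** Here P and S are the product and the sum of a conjugate pair and -n is the
third root.  As n P = c d^2, the claim compares n^3 with c d^2.  Eliminating P
and S from S^2 <= 4 P gives (c - n) (4 c n (n - d) + d^2 (c - n)) <= 0, which
fails both for d < n < c and for c < n < d.  Now r n^2 = (c - n) (d - n)^2, so
n < c when r > 0, and then n^3 >= c d^2 would force d < n; the case r < 0 is
symmetric. *)
Lemma third_root_compare (n P S r : R) : S ^+ 2 <= 4 * P ->
  S - n = r - c - 2 * d -> P - n * S = d * (2 * c + d) -> n * P = c * d ^+ 2 ->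
  [/\ 0 < n, 0 < r -> n ^+ 2 < P & r < 0 -> P < n ^+ 2].
Proof.
move=> SP e1 e2 e3.
have cd0 : 0 < c * d ^+ 2 by rewrite mulr_gt0 ?exprn_gt0.
have P0 : 0 <= P by have := sqr_ge0 S; lra.
have n0 : 0 < n.
  by rewrite ltNge; apply/negP => /mulr_le0_ge0/(_ P0); rewrite e3 leNgt cd0.
(* -n is a root. *)
have rE : r * n ^+ 2 = (c - n) * (d - n) ^+ 2.
  have -> : r = S - n + c + 2 * d by lra.
  rewrite (_ : S - n + c + 2 * d = S + (c + 2 * d - n)); last by ring.
  rewrite mulrDl (_ : S * n ^+ 2 = n * P - n * (d * (2 * c + d))).
    by rewrite e3; ring.
  by rewrite -e2; ring.
(* This is S ^ 2 <= 4 P multiplied by n ^ 4 and divided by d ^ 2. *)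
have QP : (c - n) * (4 * c * n * (n - d) + d ^+ 2 * (c - n)) <= 0.
  rewrite -(pmulr_rle0 _ (_ : 0 < d ^+ 2)) ?exprn_gt0 //.
  rewrite [leLHS](_ : _ =
    (c * d ^+ 2 - n * (d * (2 * c + d))) ^+ 2 - 4 * (c * d ^+ 2) * n ^+ 3).
    rewrite -e3 -e2 [leLHS](_ : _ = n ^+ 4 * (S ^+ 2 - 4 * P)); last by ring.
    by rewrite pmulr_rle0 ?exprn_gt0 // subr_le0.
  by ring.
split => // r0; rewrite -(ltr_pM2l n0) e3 ltNge; apply/negP => le3.
- have nc : n < c.
    rewrite ltNge -subr_le0; apply/negP => /mulr_le0_ge0/(_ (sqr_ge0 (d - n))).
    by rewrite -rE leNgt mulr_gt0 ?exprn_gt0.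
  have dn : d < n.
    rewrite -(@ltr_pXn2r _ 2) ?nnegrE ?ltW // -(ltr_pM2l c_gt0).
    by rewrite (le_lt_trans le3) // ltr_pM2r ?exprn_gt0.
  have := QP; rewrite leNgt mulr_gt0 ?subr_gt0 //.
  by rewrite addr_gt0 ?mulr_gt0 ?exprn_gt0 ?subr_gt0.
- have cn : c < n.
    rewrite ltNge -subr_ge0; apply/negP => /mulr_ge0/(_ (sqr_ge0 (d - n))).
    by rewrite -rE leNgt nmulr_rlt0 ?exprn_gt0.
  have nd : n < d.
    rewrite -(@ltr_pXn2r _ 2) ?nnegrE ?ltW // -(ltr_pM2l n0).
    by rewrite (le_lt_trans le3) // ltr_pM2r ?exprn_gt0.
  have := QP; rewrite leNgt nmulr_rgt0 ?subr_lt0 //.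
  rewrite -(addr0 0) ltrD // pmulr_rlt0 ?subr_lt0 ?exprn_gt0 //.
  by rewrite !mulr_gt0.
Qed.

Lemma conj_pair_norm z n r : splits r%:C z z^* (- n%:C) ->
  [/\ 0 < n, 0 < r -> `|- n%:C| < `|z| & r < 0 -> `|z| < `|- n%:C| :> R[i]].
Proof.
have rn (x y : R[i]) : (`|x| < `|y|) = (`|x| ^+ 2 < `|y| ^+ 2).
  by rewrite ltr_pXn2r ?nnegrE.
move=> /vieta[e1 e2 e3]; rewrite !rn normrN -!add_Re2_Im2 !ltcR.
case: z e1 e2 e3 => [x y] /(congr1 (@complex.Re R)) /= e1
  /(congr1 (@complex.Re R)) /= e2 /(congr1 (@complex.Re R)) /= e3.
rewrite expr0n addr0.
by apply: (@third_root_compare _ _ (2 * x)); have := sqr_ge0 y; lra.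
Qed.

Lemma splits_zero : splits 0 (- c%:C) (- d%:C) (- d%:C).
Proof. by move=> z; ring. Qed.
End Cubic.

(** * The curves Gamma1 and Gamma2 *)

Section Gammas.
Variables (R : realType) (a t s : R).
Hypotheses (a_gt0 : 0 < a) (t01 : 0 < t < 1) (s_gt0 : 0 < s).
Let c := a * (1 - t) ^+ 2.
Let d := s * t * (1 - t).

Let c_gt0 : 0 < c.
Proof. by case/andP: t01 => _ t1; rewrite mulr_gt0 ?exprn_gt0 ?subr_gt0. Qed.

Let d_gt0 : 0 < d.
Proof. by case/andP: t01 => t0 t1; rewrite !mulr_gt0 ?subr_gt0. Qed.

Lemma ordered_splits x z1 z2 z3 : ordered_solutions a t s x z1 z2 z3 ->
  splits c d x z1 z2 z3.
Proof.
move=> [/solutions_numerator numE _] z; have := congr1 (horner^~ z) numE.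
rewrite /= !big_cons big_nil mulr1 !hornerM !hornerXsubC mulrA => <-.
rewrite /numerator hornerD hornerN hornerM hornerZ horner_exp !hornerD !hornerC.
by rewrite hornerXn hornerX.
Qed.

Lemma splits_ordered x z1 z2 z3 : splits c d x z1 z2 z3 ->
  `|z2| <= `|z1| -> `|z3| <= `|z2| -> ordered_solutions a t s x z1 z2 z3.
Proof.
move=> sp z21 z32; split=> [z z0|].
  by rewrite -sp mulrBl mulfK ?expf_neq0.
split=> //; rewrite normr_gt0.
exact: (splits_neq0 c_gt0 d_gt0 (splitsC12 (splitsC23 sp))).
Qed.

(** The moduli in an ordered list of solutions are unique, so any one list
decides membership. *)
Lemma Gamma1P x z1 z2 z3 : ordered_solutions a t s x z1 z2 z3 ->
  Gamma1 a t s x <-> `|z1| = `|z2|.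
Proof.
move=> zP; split=> [[w1 [w2 [w3 [wP eqw]]]]|eqz]; last by exists z1, z2, z3.
by have [-> -> _] := ordered_solutions_norm zP wP.
Qed.

Lemma Gamma2P x z1 z2 z3 : ordered_solutions a t s x z1 z2 z3 ->
  Gamma2 a t s x <-> `|z2| = `|z3|.
Proof.
move=> zP; split=> [[w1 [w2 [w3 [wP eqw]]]]|eqz]; last by exists z1, z2, z3.
by have [_ -> ->] := ordered_solutions_norm zP wP.
Qed.

(** For x > 0 the conjugate pair has the larger modulus, so it provides the
first two solutions. *)
Lemma Gammas_pos (r : R) : 0 < r ->
  r * (r - crit_pos c d) * (r - crit_neg c d) <= 0 ->
  Gamma1 a t s r%:C /\ ~ Gamma2 a t s r%:C.
Proof.
move=> r0 disc_le0.
have [w1 [w2 [w3 /ordered_splits wP]]] :=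
  ordered_solutions_ex r%:C a_gt0 t01 s_gt0.
have [z [n zP]] := conj_pair c_gt0 d_gt0 wP disc_le0.
have [_ /(_ r0) nz _] := conj_pair_norm c_gt0 d_gt0 zP.
have zO : ordered_solutions a t s r%:C z z^* (- n%:C).
  by apply: splits_ordered; rewrite ?normcJ // ltW.
split; first by apply/(Gamma1P zO); rewrite normcJ.
by move/(Gamma2P zO); rewrite normcJ => zn; rewrite zn ltxx in nz.
Qed.

(** For x < 0 the conjugate pair has the smaller modulus, so it provides the
last two solutions. *)
Lemma Gammas_neg (r : R) : r < 0 ->
  r * (r - crit_pos c d) * (r - crit_neg c d) <= 0 ->
  ~ Gamma1 a t s r%:C /\ Gamma2 a t s r%:C.
Proof.
move=> r0 disc_le0.
have [w1 [w2 [w3 /ordered_splits wP]]] :=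
  ordered_solutions_ex r%:C a_gt0 t01 s_gt0.
have [z [n zP]] := conj_pair c_gt0 d_gt0 wP disc_le0.
have [_ _ /(_ r0) nz] := conj_pair_norm c_gt0 d_gt0 zP.
have zO : ordered_solutions a t s r%:C (- n%:C) z z^*.
  apply: splits_ordered; rewrite ?normcJ ?(ltW nz) //.
  exact/splitsC12/splitsC23.
split; last by apply/(Gamma2P zO); rewrite normcJ.
by move/(Gamma1P zO) => zn; rewrite zn ltxx in nz.
Qed.

(** For x = 0 the solutions are -c and, twice, -d. *)
Lemma Gamma1_0 : Gamma1 a t s 0 <-> c <= d.
Proof.
have normC (r : R) : 0 < r -> `|- r%:C| = r%:C :> R[i].
  by move=> r0; rewrite normrN gtr0_norm ?ltcR.
have [cd|dc] := leP c d.
  have zO : ordered_solutions a t s 0 (- d%:C) (- d%:C) (- c%:C).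
    apply: splits_ordered; rewrite ?normC ?lecR //.
    exact/splitsC23/splitsC12/splits_zero.
  by split=> // _; apply/(Gamma1P zO).
have zO : ordered_solutions a t s 0 (- c%:C) (- d%:C) (- d%:C).
  by apply: splits_ordered; rewrite ?normC ?lecR // ?ltW //; exact: splits_zero.
split=> // /(Gamma1P zO); rewrite !normC // => /complexI cd.
by rewrite cd ltxx in dc.
Qed.

Lemma Gamma2_0 : Gamma2 a t s 0 <-> d <= c.
Proof.
have normC (r : R) : 0 < r -> `|- r%:C| = r%:C :> R[i].
  by move=> r0; rewrite normrN gtr0_norm ?ltcR.
have [dc|cd] := leP d c.
  have zO : ordered_solutions a t s 0 (- c%:C) (- d%:C) (- d%:C).
    by apply: splits_ordered; rewrite ?normC ?lecR //; exact: splits_zero.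
  by split=> // _; apply/(Gamma2P zO).
have zO : ordered_solutions a t s 0 (- d%:C) (- d%:C) (- c%:C).
  apply: splits_ordered; rewrite ?normC ?lecR // ?ltW //.
  exact/splitsC23/splitsC12/splits_zero.
split=> // /(Gamma2P zO); rewrite !normC // => /complexI dc.
by rewrite dc ltxx in cd.
Qed.

Lemma Gamma_real x : Gamma1 a t s x \/ Gamma2 a t s x ->
  exists2 r, x = r%:C & r * (r - crit_pos c d) * (r - crit_neg c d) <= 0.
Proof.
case=> -[z1 [z2 [z3 [/ordered_splits zP eqz]]]].
  exact: (equimodular_real c_gt0 d_gt0 zP eqz).
exact: (equimodular_real c_gt0 d_gt0 (splitsC23 (splitsC12 zP)) eqz).
Qed.

Lemma Gamma1E : Gamma1 a t s = [set r%:C | r in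
  [set r : R | Num.max 0 (crit_neg c d) <= r <= crit_pos c d]].
Proof.
have gamma_gt := crit_pos_gt c_gt0 d_gt0; have m_lt := crit_neg_lt c_gt0 d_gt0.
have rP (r : R) : 0 < r -> (r * (r - crit_pos c d) * (r - crit_neg c d) <= 0) =
    (crit_neg c d <= r <= crit_pos c d).
  move=> r0; rewrite -mulrA pmulr_rle0 //.
  apply/idP/andP => [|[mr rg]]; last first.
    by rewrite mulr_le0_ge0 ?subr_le0 ?subr_ge0.
  have [rm|mr] := ltP r (crit_neg c d).
    by rewrite leNgt nmulr_rgt0 ?subr_lt0 // ?rm //; lra.
  have [gr|//] := ltP (crit_pos c d) r.
  by rewrite leNgt mulr_gt0 ?subr_gt0 //; lra.
have zP : crit_neg c d <= 0 <-> c <= d.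
  by rewrite leNgt crit_neg_gt0 // -leNgt.
apply/seteqP; split=> [x x1|_ [r /andP[]] + + <-].
  have [r xr rdisc] := Gamma_real (or_introl x1); rewrite xr in x1 *.
  exists r => //=; rewrite ge_max.
  have [r0|r0|r0] := ltgtP r 0.
  - by have [] := Gammas_neg r0 rdisc.
  - by rewrite rP in rdisc.
  - move: x1; rewrite r0 => /Gamma1_0/zP ->.
    exact: ltW (lt_trans c_gt0 gamma_gt).
rewrite ge_max le_eqVlt => /andP[/orP[/eqP r0|r0] mr] rg.
  by rewrite -r0 in mr *; apply/Gamma1_0/zP.
by apply: (Gammas_pos _ _).1 => //; rewrite rP // mr.
Qed.

Lemma Gamma2E : Gamma2 a t s = [set r%:C | r in
  [set r : R | r <= Num.min 0 (crit_neg c d)]].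
Proof.
have gamma_gt := crit_pos_gt c_gt0 d_gt0; have m_lt := crit_neg_lt c_gt0 d_gt0.
have rP (r : R) : r < 0 -> (r * (r - crit_pos c d) * (r - crit_neg c d) <= 0) =
    (r <= crit_neg c d).
  move=> r0; rewrite pmulr_rle0 ?subr_le0 // nmulr_rgt0 // subr_lt0.
  by rewrite (lt_trans r0) // (lt_trans c_gt0).
have zP : 0 <= crit_neg c d <-> d <= c.
  by rewrite leNgt crit_neg_lt0 // -leNgt.
apply/seteqP; split=> [x x2|_ [r /=] + <-].
  have [r xr rdisc] := Gamma_real (or_intror x2); rewrite xr in x2 *.
  exists r => //=; rewrite le_min.
  have [r0|r0|r0] := ltgtP r 0.
  - by rewrite rP in rdisc.
  - by have [] := Gammas_pos r0 rdisc.
  - by move: x2; rewrite r0 => /Gamma2_0/zP ->.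
rewrite le_min le_eqVlt => /andP[/orP[/eqP r0|r0] rm].
  by rewrite r0 in rm *; apply/Gamma2_0/zP.
by apply: (Gammas_neg _ _).2 => //; rewrite rP.
Qed.
End Gammas.

(** * Limits of the critical values *)

Section Limits.
Variables (R : realType) (c k : R).
Hypothesis c_gt0 : 0 < c.

Lemma saddle_cvg0 : saddle c (s * k) @[s --> 0] --> 2 * c.
Proof.
have -> : 2 * c = saddle c (0 * k).
  by rewrite /saddle mul0r expr0n /= mulr0 addr0 sqrtr0 addr0 mul0r addr0.
have sk : s * k @[s --> 0] --> 0 * k by apply: cvgMr_tmp; exact: cvg_id.
rewrite /saddle; apply: cvgD; first exact: cvg_cst.
apply: cvgMr_tmp; apply: cvgD => //.
apply: (continuous_cvg _ (f := fun s => (s * k) ^+ 2 + 8 * c * (s * k))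
  (h := @Num.sqrt R)).
  exact: sqrt_continuous.
by apply: cvgD; [rewrite !expr2; exact: cvgM | exact: cvgMl_tmp].
Qed.

Lemma crit_value_cvg (T : Type) (F : set_system T) (FF : Filter F)
    (f : T -> R) u :
  u != 0 -> f x @[x --> F] --> u ->
  crit_value c (f x) @[x --> F] --> crit_value c u.
Proof.
move=> u0 fu; rewrite /crit_value; apply: cvgM.
  apply: cvgMl_tmp; rewrite !exprS !expr0 !mulr1.
  have fc : f x - c @[x --> F] --> u - c by apply: cvgB => //; exact: cvg_cst.
  by do 2 (apply: cvgM => //).
by apply: cvgV; rewrite ?expf_neq0 // !expr2; exact: cvgM.
Qed.

Lemma crit_pos_cvg0 : crit_pos c (s * k) @[s --> 0^'+] --> c.
Proof.
apply: cvg_at_right_filter; rewrite -[X in _ --> X](crit_value_mid c_gt0).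
apply: crit_value_cvg; last exact: saddle_cvg0.
by rewrite mulf_neq0 ?gt_eqF.
Qed.

Lemma crit_neg_cvg0 : crit_neg c (s * k) @[s --> 0^'+] --> c.
Proof.
have c2 : 2 * c != 0 by rewrite mulf_neq0 ?gt_eqF.
apply: cvg_at_right_filter; rewrite -[X in _ --> X](crit_value_mid c_gt0).
apply: crit_value_cvg => //.
rewrite [X in _ --> X](_ : _ = 4 * c ^+ 2 / (2 * c)); last first.
  by field; rewrite gt_eqF.
by apply: cvgMl_tmp; apply: cvgV => //; exact: saddle_cvg0.
Qed.

Lemma crit_pos_cvgy : 0 < k -> crit_pos c (s * k) @[s --> +oo] --> +oo.
Proof.
move=> k0; apply/cvgryPge => A; near=> s.
have s0 : 0 < s by near: s; exact: nbhs_pinfty_gt.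
apply: le_trans (crit_pos_ge c_gt0 (mulr_gt0 s0 k0)).
suff : (A + 4 * c) / (4 * k) <= s by rewrite ler_pdivrMr ?mulr_gt0 //; lra.
by near: s; apply: nbhs_pinfty_ge; exact: num_real.
Unshelve. all: by end_near. Qed.

Lemma crit_neg_cvgNy : 0 < k -> crit_neg c (s * k) @[s --> +oo] --> -oo.
Proof.
move=> k0; apply/cvgrNyPle => A; near=> s.
have s0 : 0 < s by near: s; exact: nbhs_pinfty_gt.
apply: le_trans (crit_neg_le c_gt0 (mulr_gt0 s0 k0)) _.
suff : (10 * c - A) / k <= s by rewrite ler_pdivrMr //; lra.
by near: s; apply: nbhs_pinfty_ge; exact: num_real.
Unshelve. all: by end_near. Qed.
End Limits.

(** * The endpoints as functions of s *)

Theorem proposition1p4 (R : realType) (a t : R) (a_gt0 : 0 < a)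
    (t01 : 0 < t < 1) :
  let sstar := a * (1 - t) / t in
  (forall s : R, 0 < s ->
     Gamma1 a t s `<=` [set r%:C | r in [set r : R | 0 <= r]] /\
     Gamma2 a t s `<=` [set r%:C | r in [set r : R | r <= 0]]) /\
  exists eta beta gamma : R -> R,
    [/\ (forall s, 0 < s ->
           [/\ eta s <= 0, 0 <= beta s, beta s < gamma s,
               Gamma1 a t s =
                 [set r%:C | r in [set r : R | beta s <= r <= gamma s]] &
               Gamma2 a t s = [set r%:C | r in [set r : R | r <= eta s]]]),
        [/\ (forall s1 s2, 0 < s1 -> s1 < s2 -> gamma s1 < gamma s2),
            gamma s @[s --> 0^'+] --> a * (1 - t) ^+ 2 &
            gamma s @[s --> +oo] --> +oo],
        [/\ (forall s, 0 < s -> s < sstar -> 0 < beta s),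
            (forall s1 s2, 0 < s1 -> s1 < s2 -> s2 < sstar ->
               beta s2 < beta s1),
            (forall s, sstar <= s -> beta s = 0) &
            beta s @[s --> 0^'+] --> a * (1 - t) ^+ 2] &
        [/\ (forall s, 0 < s -> s <= sstar -> eta s = 0),
            (forall s, sstar < s -> eta s < 0),
            (forall s1 s2, sstar < s1 -> s1 < s2 -> eta s2 < eta s1) &
            eta s @[s --> +oo] --> -oo]].
Proof.
move=> sstar; have /andP[t0 t1] := t01.
pose c := a * (1 - t) ^+ 2; pose k := t * (1 - t).
have c0 : 0 < c by rewrite mulr_gt0 ?exprn_gt0 ?subr_gt0.
have k0 : 0 < k by rewrite mulr_gt0 ?subr_gt0.
have dE s : s * t * (1 - t) = s * k by rewrite mulrA.
have d0 s : 0 < s -> 0 < s * k by move=> s0; rewrite mulr_gt0.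
have sstarE : sstar * k = c by rewrite /sstar /k /c; field; rewrite gt_eqF.
have sstar0 : 0 < sstar by rewrite divr_gt0 ?mulr_gt0 ?subr_gt0.
have dltc s : (s * k < c) = (s < sstar) by rewrite -sstarE ltr_pM2r.
have cltd s : (c < s * k) = (sstar < s) by rewrite -sstarE ltr_pM2r.
pose gamma s := crit_pos c (s * k); pose m s := crit_neg c (s * k).
pose beta s := Num.max 0 (m s); pose eta s := Num.min 0 (m s).
have G1 s : 0 < s -> Gamma1 a t s =
    [set r%:C | r in [set r : R | beta s <= r <= gamma s]].
  by move=> s0; rewrite (Gamma1E a_gt0 t01 s0) dE.
have G2 s : 0 < s -> Gamma2 a t s = [set r%:C | r in [set r : R | r <= eta s]].
  by move=> s0; rewrite (Gamma2E a_gt0 t01 s0) dE.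
have beta0 s : 0 <= beta s by rewrite le_max lexx.
have eta0 s : eta s <= 0 by rewrite ge_min lexx.
have m_gt0 s : 0 < s -> (0 < m s) = (s < sstar).
  by move=> s0; rewrite crit_neg_gt0 ?d0.
have m_lt0 s : 0 < s -> (m s < 0) = (sstar < s).
  by move=> s0; rewrite crit_neg_lt0 ?d0.
have m_decr s1 s2 : 0 < s1 -> s1 < s2 -> m s2 < m s1.
  by move=> s0 s12; rewrite crit_neg_gt ?d0 // ltr_pM2r.
have beta_m s : 0 < s -> s < sstar -> beta s = m s.
  by move=> s0; rewrite -m_gt0 // => ms; rewrite /beta max_r ?ltW.
have eta_m s : sstar < s -> eta s = m s.
  move=> ss; have s0 := lt_trans sstar0 ss.
  by move: ss; rewrite -m_lt0 // => ms; rewrite /eta min_r ?ltW.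
split=> [s s0|].
  rewrite G1 // G2 //; split=> _ [r /= rP <-]; exists r => //=.
    by case/andP: rP => + _; exact: le_trans.
  exact: le_trans rP (eta0 s).
exists eta, beta, gamma; split.
- move=> s s0; split; rewrite ?G1 ?G2 //.
  have gamma_gt := crit_pos_gt c0 (d0 s s0).
  rewrite gt_max (lt_trans c0 gamma_gt).
  exact: lt_trans (crit_neg_lt c0 (d0 s s0)) gamma_gt.
- split; [|exact: crit_pos_cvg0|exact: crit_pos_cvgy].
  by move=> s1 s2 s0 s12; rewrite crit_pos_lt ?d0 // ltr_pM2r.
- split.
  + by move=> s s0 ss; rewrite beta_m // m_gt0.
  + move=> s1 s2 s0 s12 ss; have s20 := lt_trans s0 s12.
    by rewrite !beta_m ?m_decr // (lt_trans s12).
  + move=> s ss; have s0 := lt_le_trans sstar0 ss.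
    by rewrite /beta max_l // leNgt m_gt0 // -leNgt.
  + apply: cvg_trans (crit_neg_cvg0 k c0); apply: near_eq_cvg; near=> s.
    apply/esym/beta_m; near: s; first exact: nbhs_right_gt.
    exact: nbhs_right_lt.
- split.
  + by move=> s s0 ss; rewrite /eta min_l // leNgt m_lt0 // -leNgt.
  + by move=> s ss; rewrite eta_m // m_lt0 // (lt_trans sstar0).
  + move=> s1 s2 ss s12; have ss2 := lt_trans ss s12.
    by rewrite !eta_m // m_decr // (lt_trans sstar0).
  + apply: cvg_trans (crit_neg_cvgNy c0 k0); apply: near_eq_cvg; near=> s.
    by apply/esym/eta_m; near: s; apply: nbhs_pinfty_gt; exact: num_real.
Unshelve. all: by end_near. Qed.
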